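(* Let $\lambda>2^{\omega}$ be a regular cardinal and suppose that both $\bigstar(S)$ and $\diamondsuit(S)$ hold for some stationary set $S\subseteq E^{\lambda}_{\omega_1}$. Then: (1) there is an $\omega$-almost disjoint $\clubsuit(S^* )$-sequence for some $S^*\subseteq S$, and hence $\chi_{\rm CF}(\lambda,\omega_1,\omega)=\chi(\lambda,\omega_1,\omega)=\lambda$; (2) for every cardinal $\kappa$ with $\omega_2\le\kappa<\lambda$, $\omega_2\le\chi_{\rm CF}(\lambda,\kappa,\omega)$.
   Context: $E^{\lambda}_{\omega_1}=\{\alpha<\lambda:\operatorname{cf}(\alpha)=\omega_1\}$. $\bigstar(S)$: there is an $\omega$-almost disjoint family $\{A_\alpha:\alpha\in S\}$ (distinct members have finite intersection) such that each $A_\alpha$ is a cofinal subset of $\alpha$ of order type $\omega_1$. $\diamondsuit(S)$ is Jensen's diamond principle on $S$. For $S\subseteq\lambda$, a $\clubsuit(S)$-sequence is a sequence $\{B_\alpha:\alpha\in S\}$ with $\bigcup B_\alpha=\alpha$ for each $\alpha\in S$ such that for every $X\in[\lambda]^{\lambda}$ some $\alpha\in S$ has $B_\alpha\subseteq X$; it is $\omega$-almost disjoint if distinct $B_\alpha$ have finite intersection. For a family $\mathcal A$ (members with at least two elements) and cardinal $\rho$: $\chi(\mathcal A)$ is the least $\rho$ admitting $f:\bigcup\mathcal A\to\rho$ non-constant on each $A\in\mathcal A$; $\chi_{\rm CF}(\mathcal A)$ is the least $\rho$ admitting $f:\bigcup\mathcal A\to\rho$ such that each $A\in\mathcal A$ has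 some $\zeta$ with $|A\cap f^{-1}\{\zeta\}|=1$. A $(\lambda,\kappa,\mu)$-system is a family of $\lambda$ sets each of size $\kappa$, distinct members meeting in fewer than $\mu$ points; $\chi(\lambda,\kappa,\mu)$, $\chi_{\rm CF}(\lambda,\kappa,\mu)$ are the suprema of $\chi(\mathcal A)$, $\chi_{\rm CF}(\mathcal A)$ over all such systems. *)

(* Defs.v *)
From mathcomp Require Import all_boot all_order.
From mathcomp Require Import boolp classical_sets cardinality.
Set Implicit Arguments. Unset Strict Implicit. Unset Printing Implicit Defensive.
Import Order.TTheory.
Local Open Scope classical_set_scope.
Local Open Scope card_scope.
Local Open Scope order_scope.

(* The cardinal lambda is represented by a well-ordered type L (the ordinals
   below lambda), with order < from an orderType structure. *)
Section Defs.
Context {d : Order.disp_t} {L : orderType d}.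

(* initial segment {gamma | gamma < beta}, i.e. the ordinal beta *)
Definition seg (b : L) : set L := [set g | g < b].

Definition card_lt {T U} (A : set T) (B : set U) := A #<= B /\ ~ (B #<= A).

(* L is (the well-order of) an infinite regular cardinal lambda:
   well-founded, every proper initial segment has smaller cardinality
   (so the order type of L is a cardinal), and every unbounded subset
   has full cardinality (regularity). *)
Definition regular_cardinal_order :=
  [/\ well_founded (fun x y : L => x < y),
      forall b : L, card_lt (seg b) [set: L]
    & forall X : set L, (forall b, exists2 g, X g & b <= g) -> X #= [set: L]].

Definition otype_omega1 (C : set L) :=
  ~ countable C /\ forall g, C g -> countable (C `&` seg g).

Definition aleph1_sized {T} (X : set T) :=
  exists2 C : set L, otype_omega1 C & X #= C.

Definition le_aleph1 {T} (X : set T) :=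
  exists2 C : set L, otype_omega1 C & X #<= C.

Definition cofinal_in (B : set L) (a : L) :=
  B `<=` seg a /\ forall b, b < a -> exists2 g, B g & b < g.

Definition cf_omega1 (a : L) :=
  (exists B, cofinal_in B a /\ aleph1_sized B) /\
  forall B, cofinal_in B a -> ~ countable B.

Definition E_omega1 : set L := [set a | cf_omega1 a].

Definition closed_set (C : set L) :=
  forall a, (exists b, b < a) ->
    (forall b, b < a -> exists g, [/\ C g, b < g & g < a]) -> C a.
Definition unbounded (C : set L) := forall b, exists2 g, C g & b <= g.
Definition club (C : set L) := closed_set C /\ unbounded C.
Definition stationary (S : set L) := forall C, club C -> exists a, S a /\ C a.

Definition almost_disjoint_on (S : set L) (A : L -> set L) :=
  forall a b, S a -> S b -> a <> b -> finite_set (A a `&` A b).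

Definition bigstar (S : set L) :=
  exists A : L -> set L,
    (forall a, S a -> cofinal_in (A a) a /\ otype_omega1 (A a)) /\
    almost_disjoint_on S A.

Definition diamond (S : set L) :=
  exists A : L -> set L,
    (forall a, S a -> A a `<=` seg a) /\
    forall X : set L, stationary [set a | S a /\ X `&` seg a = A a].

Definition clubsuit_seq (S : set L) (B : L -> set L) :=
  (forall a, S a -> cofinal_in (B a) a) /\
  forall X : set L, X #= [set: L] -> exists a, S a /\ B a `<=` X.

(* (lambda, kappa, omega)-systems on a ground type T, indexed injectively by L;
   sz describes "has size kappa". Distinct members meet in finitely many points
   (this also forces the members to be distinct). *)
Definition system {T} (sz : set T -> Prop) (A : L -> set T) :=
  (forall i, sz (A i)) /\ forall i j, i <> j -> finite_set (A i `&` A j).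

Definition colorable {T} (A : L -> set T) (Col : set L) :=
  exists f : T -> L, (forall i x, A i x -> Col (f x)) /\
    forall i, exists x y, [/\ A i x, A i y & f x <> f y].

Definition cf_colorable {T} (A : L -> set T) (Col : set L) :=
  exists f : T -> L, (forall i x, A i x -> Col (f x)) /\
    forall i, exists z, exists2 x, (A i x /\ f x = z) &
                         forall y, A i y -> f y = z -> y = x.

(* sup{ chi(A) : A a (lambda,kappa,omega)-system } = lambda, where "colorable"
   is chi or chi_CF: every system has chi(A) <= lambda, and for every cardinal
   rho = |beta| < lambda some system has chi(A) > rho. *)
Definition sup_is_lambda
  (col : forall T : Type, (L -> set T) -> set L -> Prop)
  (sz : forall T : Type, set T -> Prop) :=
  (forall (T : Type) (A : L -> set T), system (sz T) A -> col T A [set: L]) /\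
  (forall b : L, exists (T : Type) (A : L -> set T),
      system (sz T) A /\ ~ col T A (seg b)).

End Defs.

(* Main.v *)
Require Import Defs.
From mathcomp Require Import all_boot all_order.
From mathcomp Require Import boolp classical_sets cardinality.
From mathcomp Require Import functions.
Import Order.TTheory.
Local Open Scope classical_set_scope.
Local Open Scope card_scope.
Local Open Scope order_scope.

Set Implicit Arguments.
Unset Strict Implicit.
Unset Printing Implicit Defensive.

(** Given the bigstar family [A], the diamond sequence [D] and a set [X] of size
   lambda, fix an injection [i : lambda -> X]; then the sets [i @` A a] are
   almost disjoint and, for club many [a] with [X `&` seg a = D a], cofinal
   subsets of [D a]. One cannot take all of them for all [X] at once, so [B a] is
   chosen by recursion on [a]: it is any set of size omega_1, cofinal in [a],
   contained in [D a] and almost disjoint from all earlier choices, if there is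
   one. If the choice failed at all [a] guessing [X], some earlier [B b], [b < a],
   would meet [i @` A a] in an infinite set. By pressing down one [b] serves
   unboundedly many [a]; as a set of size omega_1 is an increasing union of
   omega_1 countable sets, each with only 2^omega < lambda subsets, two distinct
   [a]s would then share an infinite countable set, a contradiction.

   For part (2) the same recursion is run on lambda * kappa, diamond guessing a
   colouring of it by omega_1 colours. [B a] now picks at most one point from each
   column and carries each colour occurring unboundedly often below [a], none of
   them just once; the [a]-th member of the system is [B a] together with kappa
   many points of the [a]-th column. *)

(** * Injections and comparison of cardinals *)

Definition inj_on {T U} (A : set T) (f : T -> U) :=
  forall x y, A x -> A y -> f x = f y -> x = y.

Lemma card_le_of_inj {T U} (A : set T) (B : set U) (f : T -> U) :
  inj_on A f -> (forall x, A x -> B (f x)) -> A #<= B.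
Proof.
move=> fI fAB; have [g] : $|{injfun A >-> B}|.
  by apply/injfunPex; exists f => // x y /set_mem Ax /set_mem Ay; apply: fI.
exact: inj_card_le g.
Qed.

Lemma inj_of_card_le {T U} (u0 : U) (A : set T) (B : set U) :
  A #<= B -> exists2 f : T -> U, inj_on A f & forall x, A x -> B (f x).
Proof.
elim/Ppointed: U => U in u0 B *; first by case: (no u0).
move=> /pcard_leP/injfunPex[f fAB fI]; exists f => //.
by move=> x y Ax Ay; apply: fI; rewrite inE.
Qed.

Lemma bij_of_card_eq {T U} (u0 : U) (A : set T) (B : set U) :
  A #= B -> exists f : T -> U, [/\ inj_on A f, forall x, A x -> B (f x) &
    forall y, B y -> exists2 x, A x & f x = y].
Proof.
elim/Ppointed: U => U in u0 B *; first by case: (no u0).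
move=> /card_set_bijP[f [fAB fI fS]]; exists f; split => //.
  by move=> x y Ax Ay; apply: fI; rewrite inE.
Qed.

Lemma card_eq_image_inj_on {T U} (A : set T) (f : T -> U) :
  inj_on A f -> f @` A #= A.
Proof. by move=> fI; apply: inj_card_eq => x y /set_mem Ax /set_mem Ay; apply: fI. Qed.

Lemma countable_setU T (A B : set T) :
  countable A -> countable B -> countable (A `|` B).
Proof.
move=> Ac Bc; apply: (@sub_countable _ _ _
    (\bigcup_(b in [set: bool]) if b then A else B)).
  by apply: subset_card_le => x [Ax|Bx]; [exists true|exists false].
by apply: bigcup_countable => // -[].
Qed.

(** * Sets of order type omega_1 *)

Section WellFounded.
Context {d : Order.disp_t} {L : orderType d}.
Hypothesis wfL : well_founded (fun x y : L => x < y).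

Lemma wf_rec U (F : forall i : L, (forall j, j < i -> U) -> U) :
  exists f : L -> U, forall i, f i = F i (fun j _ => f j).
Proof.
exists (Fix wfL (fun _ => U) F) => i; apply: Fix_eq => x f g fg.
congr (F x _); apply: functional_extensionality_dep => j.
by apply: functional_extensionality_dep => ji; apply: fg.
Qed.

Lemma ex_least (X : set L) : X !=set0 -> exists2 m, X m & forall x, X x -> m <= x.
Proof.
case=> x; elim/(well_founded_ind wfL): x => x IH Xx.
have [[y yx Xy]|nex] := pselect (exists2 y, y < x & X y); first exact: IH Xy.
exists x => // y Xy; rewrite leNgt; apply/negP => yx; apply: nex.
by exists y.
Qed.

(** By recursion along [C]: at each stage only countably many points of [Y] have been used, so two
    fresh ones remain. The second copy later makes every colour occur at least twice. *)
Lemma otype_omega1_twofold_inj U (C : set L) (Y : set U) (u0 : U) :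
  otype_omega1 C -> ~ countable Y ->
  exists g : bool -> L -> U,
    (forall b x, C x -> Y (g b x)) /\
    (forall b b' x x', C x -> C x' -> g b x = g b' x' -> b = b' /\ x = x').
Proof.
move=> [_ Cseg] Yunc.
have pick (W : set U) : countable W -> exists2 y, Y y & ~ W y.
  move=> Wc; apply: contrapT => nex; apply: Yunc.
  apply: sub_countable Wc; apply: subset_card_le => y Yy.
  by apply: contrapT => nWy; apply: nex; exists y.
have pick2 (W : set U) : exists p : U * U, countable W ->
    [/\ Y p.1, Y p.2, ~ W p.1, ~ W p.2 & p.1 <> p.2].
  have [Wc|nWc] := pselect (countable W); last by exists (u0, u0).
  have [y Yy nWy] := pick _ Wc.
  have [|z Yz nz] := pick (W `|` [set y]).
    by apply: countable_setU => //; apply: countable1.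
  by exists (y, z) => _; split => //= [Wz|yz]; apply: nz; [left|right].
have [c cP] := choice pick2.
pose W (i : L) (h : forall j, j < i -> U * U) : set U :=
  \bigcup_(j in C `&` seg i)
    [set u | exists ji : j < i, u = (h j ji).1 \/ u = (h j ji).2].
have [f fE] := wf_rec (fun i h => c (W i h)).
pose V i := W i (fun j _ => f j).
have Vc i : C i -> countable (V i).
  move=> Ci; apply: bigcup_countable => [|j [Cj ji]]; first exact: Cseg.
  apply: (@sub_countable _ _ _ [set (f j).1; (f j).2]).
    by apply: subset_card_le => u [ji' [->|->]]; [left|right].
  exact/finite_set_countable/finite_set2.
have fP i : C i -> [/\ Y (f i).1, Y (f i).2, ~ V i (f i).1, ~ V i (f i).2 &
   (f i).1 <> (f i).2].
  by move=> Ci; have := cP _ (Vc i Ci); rewrite /V -fE.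
pose g (b : bool) x := if b then (f x).1 else (f x).2.
have gV b x x' : C x -> x < x' -> V x' (g b x).
  by move=> Cx xx'; exists x => //; exists xx'; case: b; [left|right].
have gNV b x : C x -> ~ V x (g b x) by move=> /fP[*]; case: b.
exists g; split => [b x /fP[*]|b b' x x' Cx Cx' gE]; first by case: b.
have xE : x = x'.
  case: (ltgtP x x') => // xx'; exfalso.
    by apply: (gNV b' x') => //; rewrite -gE; apply: gV.
  by apply: (gNV b x) => //; rewrite gE; apply: gV.
split=> //; move: gE; rewrite -xE.
by have [_ _ _ _ ne] := fP x Cx; case: b; case: b' => //= /esym.
Qed.

Lemma otype_omega1_card_le U (C : set L) (Y : set U) :
  otype_omega1 C -> ~ countable Y -> C #<= Y.
Proof.
move=> oC Yunc; have [u0 _] : Y !=set0.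
  by apply/set0P/eqP => Y0; apply: Yunc; rewrite Y0; apply: countable0.
have [g [gY gI]] := otype_omega1_twofold_inj u0 oC Yunc.
apply: (@card_le_of_inj _ _ _ _ (g true)) => [x y Cx Cy|x]; last exact: gY.
by move=> /(gI _ _ _ _ Cx Cy)[].
Qed.

Lemma otype_omega1_card_eq (C C' : set L) :
  otype_omega1 C -> otype_omega1 C' -> C #= C'.
Proof.
move=> oC oC'; rewrite card_eq_le; apply/andP; split.
  by apply: otype_omega1_card_le => //; case: oC'.
by apply: otype_omega1_card_le => //; case: oC.
Qed.

Lemma aleph1_sizedE T (X : set T) (C : set L) :
  otype_omega1 C -> aleph1_sized (L := L) X -> X #= C.
Proof.
move=> oC [C' oC' XC']; apply: card_eq_trans XC' _.
exact: otype_omega1_card_eq.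
Qed.

Lemma aleph1_sized_uncountable T (X : set T) : aleph1_sized (L := L) X -> ~ countable X.
Proof. by move=> [C [nC _] XC]; rewrite (eq_countable XC). Qed.

Lemma otype_omega1_twofold_surj (A C : set L) (c0 : L) :
  otype_omega1 A -> otype_omega1 C -> C c0 ->
  exists k : L -> L, (forall x, C (k x)) /\
    forall c, C c -> exists x y, [/\ A x, A y, x <> y, k x = c & k y = c].
Proof.
move=> [uA _] oC Cc0.
have [g [gA gI]] := otype_omega1_twofold_inj c0 oC uA.
have [x|k kP] := @choice L L
    (fun x y => C y /\ forall b c, C c -> x = g b c -> y = c).
  have [[b [c [Cc xE]]]|nex] := pselect (exists b c, C c /\ x = g b c).
    exists c; split => // b' c' Cc' xE'.
    by have [] := gI b b' c c' Cc Cc'; rewrite -?xE.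
  exists c0; split => // b c Cc xE; case: nex; by exists b, c.
exists k; split => [x|c Cc]; first by case: (kP x).
exists (g true c), (g false c); split; try exact: gA.
- by move=> /(gI _ _ _ _ Cc Cc)[].
- by have [_] := kP (g true c); apply; first exact: Cc.
- by have [_] := kP (g false c); apply; first exact: Cc.
Qed.

(* The cofinality of omega_1 is uncountable, so a countable infinite subset of
   [Y] is already caught by one of the countable pieces. *)
Lemma aleph1_sized_pieces T (B : set T) : aleph1_sized (L := L) B ->
  exists (C : set L) (W : L -> set T), [/\ otype_omega1 C,
    forall g, C g -> countable (W g) &
    forall Y, Y `<=` B -> infinite_set Y -> exists2 g, C g & infinite_set (Y `&` W g)].
Proof.
move=> [C oC BC]; have [uC Cseg] := oC.
have [c0 _] : C !=set0.
  by apply/set0P/eqP => C0; apply: uC; rewrite C0; apply: countable0.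
have [f [fI fC _]] := bij_of_card_eq c0 BC.
exists C, (fun g => [set x | B x /\ f x < g]); split => // [g Cg|Y YB].
  apply: sub_countable (Cseg g Cg); apply: (@card_le_of_inj _ _ _ _ f).
    by move=> x y [Bx _] [By _]; apply: fI.
  by move=> x [Bx xg]; split => //; apply: fC.
move=> /infiniteP NY.
have [t0 Yt0] : Y !=set0.
  by apply: infinite_setN0; apply/infiniteP.
have [s sI sY] := inj_of_card_le t0 NY.
(* If no point of [C] lay above all [f (s n)], countably many countable initial segments would cover
   [C]. *)
have [g Cg gP] : exists2 g, C g & forall n, f (s n) < g.
  apply: contrapT => nex; apply: uC.
  apply: (@sub_countable _ _ _ (\bigcup_(n in [set: nat])
      ((C `&` seg (f (s n))) `|` [set f (s n)]))).
    apply: subset_card_le => g Cg; apply: contrapT => ng; apply: nex.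
    exists g => // n; rewrite ltNge; apply/negP; rewrite le_eqVlt => /orP[/eqP gE|gl].
      by apply: ng; exists n => //; right.
    by apply: ng; exists n => //; left.
  apply: bigcup_countable => // n _.
  have fsC : C (f (s n)) by apply/fC/YB/sY.
  by apply: countable_setU; [exact: Cseg|exact: countable1].
exists g => //; apply/infiniteP; apply: (@card_le_of_inj _ _ _ _ s) => //.
by move=> n _; split; [apply: sY|split => //; apply/YB/sY].
Qed.

End WellFounded.

(** * Regular cardinals *)

(** The members may live outside the index type: part (2) uses subsets of [L * L]. *)
Definition almost_disjoint {I T} (S : set I) (A : I -> set T) :=
  forall a b, S a -> S b -> a <> b -> finite_set (A a `&` A b).

Section Regular.
Context {d : Order.disp_t} {L : orderType d}.
Hypothesis regL : regular_cardinal_order (L := L).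
Hypothesis contL : card_lt [set: set nat] [set: L].

Let wfL : well_founded (fun x y : L => x < y). Proof. by case: regL. Qed.

(* For regular lambda this says |X| < lambda. *)
Definition small {T} (X : set T) :=
  forall g : T -> L, exists b, forall x, X x -> g x < b.

Lemma bounded_or_full (X : set L) :
  (exists b, forall x, X x -> x < b) \/ X #= [set: L].
Proof.
case: regL => _ _ fullX.
have [Xu|nXu] := pselect (forall b, exists2 g, X g & b <= g).
  by right; apply: fullX.
left; apply: contrapT => nex; apply: nXu => b; apply: contrapT => nb.
apply: nex; exists b => x Xx; rewrite ltNge; apply/negP => bx.
by apply: nb; exists x.
Qed.

Lemma small_of_card T (X : set T) : ~ ([set: L] #<= X) -> small X.
Proof.
move=> nX g; have [[b bP]|gX] := bounded_or_full (g @` X).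
  by exists b => x Xx; apply: bP; exists x.
case: nX; apply: card_le_trans (card_image_le g X).
by have := card_esym gX; rewrite card_eq_le => /andP[].
Qed.

Lemma small_countable T (X : set T) : countable X -> small X.
Proof.
move=> Xc; apply: small_of_card => LX; case: contL => _; apply.
apply: card_le_trans LX (card_le_trans Xc _).
apply: (@card_le_of_inj _ _ _ _ (fun n : nat => [set n])) => // x y _ _ xy.
by have : [set x] x by []; rewrite xy.
Qed.

Lemma ex_point : exists l0 : L, True.
Proof.
apply: contrapT => nL; case: contL => _; apply.
by apply: (@card_le_of_inj _ _ _ _ (fun _ => set0)) => // x; case: nL; exists x.
Qed.

Lemma small_sub T (X Y : set T) : X `<=` Y -> small Y -> small X.
Proof. by move=> XY sY g; have [b bP] := sY g; exists b => x /XY/bP. Qed.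

Lemma small_le T U (X : set T) (Y : set U) : X #<= Y -> small Y -> small X.
Proof.
have [l0 _] := ex_point.
move=> XY sY g; have [[x0 Xx0]|X0] := pselect (X !=set0); last first.
  by exists l0 => x Xx; case: X0; exists x.
have [u0 _] : exists u0 : U, True.
  apply: contrapT => nU; move: XY; have -> : Y = set0.
    by apply/seteqP; split => // u; case: nU; exists u.
  by move=> /card_le0P XE; move: Xx0; rewrite XE.
have [f fI fY] := inj_of_card_le u0 XY.
have [y|g' g'P] := @choice U L (fun y z => forall x, X x -> f x = y -> z = g x).
  have [[x Xx fxy]|nex] := pselect (exists2 x, X x & f x = y); last first.
    by exists l0 => x Xx fxy; case: nex; exists x.
  by exists (g x) => x' Xx' fx'y; congr g; apply: fI => //; rewrite fxy.
have [b bP] := sY g'; exists b => x Xx.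
by rewrite -(g'P (f x) x) //; apply/bP/fY.
Qed.

Lemma small_image T U (X : set T) : small X -> forall f : T -> U, small (f @` X).
Proof. by move=> sX f g; have [b bP] := sX (g \o f); exists b => _ [x Xx <-]; apply: bP. Qed.

Lemma small_seg (b : L) : small (seg b).
Proof. by apply: small_of_card; case: regL => _ /(_ b)[]. Qed.

Lemma ex_gt (b : L) : exists b', b < b'.
Proof. by have [b' b'P] := small_countable (countable1 b) id; exists b'; apply: b'P. Qed.

Lemma small_bigcup T I (D : set I) (F : I -> set T) :
  small D -> (forall i, D i -> small (F i)) -> small (\bigcup_(i in D) F i).
Proof.
have [l0 _] := ex_point.
move=> sD sF g.
have [i|h hP] := @choice I L (fun i b => D i -> forall x, F i x -> g x < b).
  have [Di|nDi] := pselect (D i); last by exists l0.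
  by have [b bP] := sF i Di g; exists b.
have [b bP] := sD h; exists b => x [i Di Fix].
exact: lt_trans (hP i Di x Fix) (bP i Di).
Qed.

Lemma small_setX T U (A : set T) (B : set U) : small A -> small B ->
  small [set z | A z.1 /\ B z.2].
Proof.
move=> sA sB; apply: (@small_sub _ _ (\bigcup_(x in A) ((fun y => (x, y)) @` B))).
  by move=> [x y] [/= Ax By]; exists x => //; exists y.
by apply: small_bigcup => // x _; apply: small_image.
Qed.

(** This is where omega_1 < lambda comes from: a point of cofinality omega_1 has uncountably many
    predecessors, so [C] injects into a proper initial segment. *)
Lemma small_otype_omega1 (a : L) (C : set L) :
  cf_omega1 a -> otype_omega1 C -> small C.
Proof.
move=> [[B [[Ba _] B1]] cfa] oC; apply: small_le (small_seg a).
apply: (@otype_omega1_card_le _ _ wfL) => // ca; apply: (aleph1_sized_uncountable B1).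
by apply: sub_countable ca; apply: subset_card_le.
Qed.

(** * Closure points and stationary sets *)

Definition closed_under (h : L -> L) (a : L) := forall b, b < a -> h b < a.

Lemma club_closed_under (h : L -> L) : club [set a | closed_under h a].
Proof.
split=> [a _ aP b ba|b].
  by have [g [gh bg ga]] := aP b ba; apply: lt_trans (gh b bg) ga.
(* The limit of the iterates of [k] from [b] is closed under [h], because [k x] exceeds [h y] for
   all [y <= x]. *)
have [x|k kP] := @choice L L (fun x z => x < z /\ forall y, y <= x -> h y < z).
  have [x' xx'] := ex_gt x.
  have [z zP] := small_seg x' (fun y => Order.max y (h y)).
  exists z; split=> [|y yx].
    by have := zP x xx'; rewrite gt_max => /andP[].
  by have := zP y (le_lt_trans yx xx'); rewrite gt_max => /andP[].
pose u n := iter n k b.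
have [c0 c0P] := small_countable (countableP [set: nat]) u.
have [|c cP cmin] := @ex_least _ _ wfL [set c | forall n, u n < c].
  by exists c0 => n; apply: c0P.
exists c; last exact: ltW (cP 0%N).
move=> y yc; have [n yn] : exists n, y <= u n.
  apply: contrapT => nex; have : c <= y; last by rewrite leNgt yc.
  apply: cmin => n /=; rewrite ltNge; apply/negP => yn; apply: nex; by exists n.
by apply: lt_trans (cP n.+1); apply: (kP (u n)).2.
Qed.

(** Stationarity tested on clubs of closure points only; two such clubs are intersected by taking
    the maximum of the functions. *)
Definition meets_closed (E : set L) := forall h, exists2 a, E a & closed_under h a.

Lemma stationary_meets_closed (E : set L) : stationary E -> meets_closed E.
Proof. by move=> sE h; have [a [Ea ha]] := sE _ (club_closed_under h); exists a. Qed.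

Lemma meets_closedI (E : set L) (h : L -> L) :
  meets_closed E -> meets_closed [set a | E a /\ closed_under h a].
Proof.
move=> mE h'; have [a Ea aP] := mE (fun b => Order.max (h b) (h' b)).
by exists a => [|b /aP]; [split => // b /aP|]; rewrite gt_max => /andP[].
Qed.

(** Points closed under the constant function [b0] lie above [b0], except the least element, which
    is vacuously closed; hence the second hypothesis. *)
Lemma meets_closed_unbounded (E : set L) b0 : meets_closed E ->
  (forall a, E a -> exists b, b < a) -> meets_closed [set a | E a /\ b0 < a].
Proof.
move=> mE E0 h; have [a [Ea ha] aP] := meets_closedI (fun=> b0) mE h.
by exists a => //; split => //; have [b /ha] := E0 a Ea.
Qed.

(** * Injecting unions of small sets into lambda *)

Lemma spaced (n : L -> L -> L) : exists o : L -> L,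
  (forall i, i <= o i) /\ forall k i, k < i -> n k (o k) < o i.
Proof.
have [l0 _] := ex_point.
(* [c] chooses a strict upper bound of a bounded [W]; the recursion puts [o i] above [i] and above
   every [n j (o j)] with [j < i]. *)
have [W|c cP] := @choice (set L) L
    (fun W c => forall b, (forall x, W x -> x < b) -> forall x, W x -> x < c).
  have [[b bP]|nex] := pselect (exists b, forall x, W x -> x < b).
    by exists b => ? _.
  by exists l0 => b bP; case: nex; exists b.
pose W (i : L) (f : forall j, j < i -> L) : set L :=
  [set y | y = i \/ exists j (ji : j < i), y = n j (f j ji)].
have [o oE] := wf_rec wfL (fun i f => c (W i f)).
have oP i y : W i (fun j _ => o j) y -> y < o i.
  have [b bP] := small_seg i (fun j => n j (o j)).
  have [b' ib'] := ex_gt i.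
  rewrite oE; apply: (cP _ (Order.max b b')) => x [->|[j [ji ->]]]; rewrite lt_max.
    by rewrite ib' orbT.
  by rewrite bP.
exists o; split=> [i|k i ki]; first by apply/ltW/oP; left.
by apply: oP; right; exists k, ki.
Qed.

(** The sets are copied into disjoint blocks: [j o] moves the values of [phi k] into the tail from
    [o] on, smallness of [G k] bounds the block by [n k o], and [spaced] keeps the blocks apart.
    Each point goes to the block of one chosen index [r x]. *)
Lemma inj_on_bigcup T (G : L -> set T) :
  (forall i, small (G i)) -> (forall i, exists phi : T -> L, inj_on (G i) phi) ->
  exists f : T -> L, inj_on (\bigcup_i G i) f.
Proof.
have [l0 _] := ex_point.
move=> sG /choice[phi phiI].
have [o|j jP] := @choice L (L -> L) (fun o j => injective j /\ forall x, o <= j x).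
  have [[b bP]|oL] := bounded_or_full [set x | o <= x].
    have [b' bb'] := ex_gt (Order.max o b); move: bb'; rewrite gt_max => /andP[ob' bb'].
    by have := bP b' (ltW ob'); rewrite ltNge (ltW bb').
  have := card_esym oL; rewrite card_eq_le => /andP[/(inj_of_card_le l0)[j jI jo] _].
  by exists j; split=> [x y|x]; [apply: jI|apply: jo].
have [k|n nP] := @choice L (L -> L)
    (fun k n => forall o x, G k x -> j o (phi k x) < n o).
  have [o|n nP] := @choice L L (fun o y => forall x, G k x -> j o (phi k x) < y).
    by have [b bP] := sG k (fun x => j o (phi k x)); exists b.
  by exists n.
have [o [_ oP]] := spaced n.
have [x|r rP] := @choice T L (fun x r => (\bigcup_i G i) x -> G r x).
  by have [[i _ Gi]|nx] := pselect ((\bigcup_i G i) x); [exists i|exists l0].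
pose f x := j (o (r x)) (phi (r x) x).
have lt_f x y : (\bigcup_i G i) x -> r x < r y -> f x < f y.
  move=> Gx rxy; apply: lt_le_trans (nP _ (o (r x)) x (rP x Gx)) _.
  by apply: le_trans (ltW (oP _ _ rxy)) _; apply: (jP _).2.
exists f => x y Gx Gy fxy; case: (ltgtP (r x) (r y)) => rxy.
- by have := lt_f x y Gx rxy; rewrite fxy ltxx.
- by have := lt_f y x Gy rxy; rewrite fxy ltxx.
- move: fxy; rewrite /f rxy => /(jP _).1; apply: (phiI (r y)); last exact: rP.
  by rewrite -rxy; apply: rP.
Qed.

(** * Almost disjoint families *)

(* A countable set has at most 2^omega < lambda subsets, so among the
   almost disjoint [A a] only few can meet it in an infinite set. *)
Lemma infinite_meets_countable T (S : set L) (A : L -> set T) (W : set T) :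
  almost_disjoint S A -> countable W ->
  exists b, forall a, S a -> infinite_set (A a `&` W) -> a < b.
Proof.
have [l0 _] := ex_point.
move=> adA Wc; set X := [set a | S a /\ infinite_set (A a `&` W)].
have [[b bP]|XL] := bounded_or_full X; first by exists b => a Sa Wa; apply: bP.
exfalso; case: contL => _; apply.
have := card_esym XL; rewrite card_eq_le => /andP[LX _]; apply: card_le_trans LX _.
have [f fI _] := inj_of_card_le 0%N Wc.
apply: (@card_le_of_inj _ _ _ _ (fun a => f @` (A a `&` W))) => // a b.
move=> [Sa ia] [Sb _] fE; apply: contrapT => nab; apply: ia.
apply: sub_finite_set (adA a b Sa Sb nab) => x [Ax Wx]; split => //.
have : (f @` (A b `&` W)) (f x) by rewrite -fE; exists x.
by move=> [y [Ay Wy] /fI <-].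
Qed.

(** An infinite meet with [B] is already infinite on one of omega_1 countable pieces of [B]. Each
    piece gives a bound, and omega_1 < lambda bounds these bounds. *)
Lemma infinite_meets_bounded T (S : set L) (A : L -> set T) (B : set T) (a1 : L) :
  cf_omega1 a1 -> almost_disjoint S A -> aleph1_sized (L := L) B ->
  exists b, forall a, S a -> infinite_set (A a `&` B) -> a < b.
Proof.
have [l0 _] := ex_point.
move=> cfa1 adA /(aleph1_sized_pieces)[C [W [oC Wc WP]]].
have [g|h hP] := @choice L L (fun g b => C g ->
    forall a, S a -> infinite_set (A a `&` W g) -> a < b).
  have [Cg|nCg] := pselect (C g); last by exists l0.
  by have [b bP] := infinite_meets_countable adA (Wc g Cg); exists b.
have [b bP] := small_otype_omega1 cfa1 oC h.
exists b => a Sa iA; have [|g Cg ig] := WP _ _ iA; first by move=> x [].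
apply: lt_trans (bP g Cg); apply: hP => //.
by apply: sub_infinite_set ig => x [[? ?] ?].
Qed.

(* [S'] and [B] are built greedily: [a] is taken whenever some acceptable set at
   [a] is almost disjoint from all earlier choices. If all the [A a], [a] in [E],
   were refused, then by pressing down a single [B b] would have an infinite
   intersection with unboundedly many of them. *)
Lemma greedy_almost_disjoint T (acc : L -> set T -> Prop) (a1 : L) :
  cf_omega1 a1 -> (forall a B, acc a B -> aleph1_sized (L := L) B) ->
  exists (S' : set L) (B : L -> set T),
    [/\ forall a, S' a -> acc a (B a), almost_disjoint S' B &
      forall E A, meets_closed E -> almost_disjoint E A ->
        (forall a, E a -> acc a (A a)) -> exists2 a, E a & S' a].
Proof.
move=> cfa1 acc1; have [l0 _] := ex_point.
pose P a (W : set (set T)) B := acc a B /\ forall B', W B' -> finite_set (B' `&` B).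
(* [None] is returned only when no acceptable set is compatible with the earlier choices. *)
have [[a W]|c cP] := @choice (L * set (set T)) (option (set T)) (fun aW o =>
    (forall B, o = Some B -> P aW.1 aW.2 B) /\ (o = None -> forall B, ~ P aW.1 aW.2 B)).
  have [[B PB]|nP] := pselect (exists B, P a W B).
    by exists (Some B); split => // _ [<-].
  by exists None; split => // _ B PB; apply: nP; exists B.
pose W (a : L) (f : forall b, b < a -> option (set T)) : set (set T) :=
  [set B | exists b (ba : b < a), f b ba = Some B].
have [f fE] := wf_rec wfL (fun a f => c (a, W a f)).
pose V a := W a (fun b _ => f b).
have fS a B : f a = Some B -> P a (V a) B.
  by rewrite fE => /(cP (a, V a)).1.
have fN a : f a = None -> forall B, ~ P a (V a) B.
  by rewrite fE => /(cP (a, V a)).2.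
pose B a := odflt set0 (f a); pose S' : set L := [set a | f a <> None].
have fB a : S' a -> f a = Some (B a) by rewrite /S' /B /=; case: (f a).
have adB a b : S' a -> S' b -> a < b -> finite_set (B a `&` B b).
  move=> S'a S'b ab; have [_] := fS _ _ (fB b S'b); apply.
  by exists a, ab; apply: fB.
exists S', B; split => [a /fB/fS[] //|a b S'a S'b ab|E A mE adA accA].
  case: (ltgtP a b) => // lab; first exact: adB.
  by rewrite setIC; apply: adB.
apply: contrapT => nES'.
have [b|h hP] := @choice L L (fun b z => S' b ->
    forall a, E a -> infinite_set (A a `&` B b) -> a < z).
  have [S'b|nS'b] := pselect (S' b); last by exists l0.
  have [z zP] := infinite_meets_bounded cfa1 adA (acc1 _ _ (fS _ _ (fB b S'b)).1).
  by exists z.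
(* If this [a] is refused, some earlier [B b] meets [A a] in an infinite set, whence
   [a < h b < a]. *)
have [a Ea ha] := mE h.
have faN : f a = None by apply: contrapT => S'a; apply: nES'; exists a.
apply: (fN a faN (A a)); split; first exact: accA.
move=> B' [b [ba fb]]; apply: contrapT => iB'.
have S'b : S' b by rewrite /S' /= fb.
have B'E : B' = B b by rewrite /B fb.
have := hP b S'b a Ea; rewrite setIC -B'E => /(_ iB') ab.
by have := lt_trans ab (ha b ba); rewrite ltxx.
Qed.

End Regular.

(** * Guessing *)

Lemma card_leU {T U} (u0 : U) (A B : set T) (A' B' : set U) :
  A #<= A' -> B #<= B' -> A' `&` B' = set0 -> A `|` B #<= A' `|` B'.
Proof.
move=> /(inj_of_card_le u0)[f fI fA] /(inj_of_card_le u0)[g gI gB] dAB.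
have dj u : A' u -> B' u -> False by move=> A'u B'u; rewrite -[False]/(set0 u) -dAB.
have [x|h hP] := @choice T U (fun x y => (A x -> y = f x) /\ (~ A x -> y = g x)).
  by have [Ax|nAx] := pselect (A x); [exists (f x)|exists (g x)].
have hA x : A x -> h x = f x := (hP x).1.
have hB x : ~ A x -> h x = g x := (hP x).2.
apply: (@card_le_of_inj _ _ _ _ h) => [x y ABx ABy|x ABx].
  have [Ax|nAx] := pselect (A x); have [Ay|nAy] := pselect (A y).
  - by rewrite !hA //; apply: fI.
  - rewrite hA // hB // => fg; case: (dj (f x)); first exact: fA.
    by rewrite fg; apply: gB; case: ABy.
  - rewrite hB // hA // => gf; case: (dj (f y)); first exact: fA.
    by rewrite -gf; apply: gB; case: ABx.
  - by rewrite !hB //; apply: gI; [case: ABx|case: ABy].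
have [Ax|nAx] := pselect (A x); first by left; rewrite hA //; apply: fA.
by right; rewrite hB //; apply: gB; case: ABx.
Qed.

Lemma card_eqU {T U} (t0 : T) (u0 : U) (A B : set T) (A' B' : set U) :
  A #= A' -> B #= B' -> A `&` B = set0 -> A' `&` B' = set0 ->
  A `|` B #= A' `|` B'.
Proof.
rewrite !card_eq_le => /andP[AA' A'A] /andP[BB' B'B] dAB dAB'.
by apply/andP; split; apply: card_leU.
Qed.

Lemma finite_subsingleton T (A : set T) :
  (forall x y, A x -> A y -> x = y) -> finite_set A.
Proof.
move=> A1; have [[x Ax]|nA] := pselect (A !=set0).
  by apply: sub_finite_set (finite_set1 x) => y Ay; apply: A1.
by apply: sub_finite_set (finite_set0 T) => y Ay; case: nA; exists y.
Qed.

Lemma uncountable_neq T (A : set T) (x : T) : ~ countable A -> exists2 y, A y & y <> x.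
Proof.
move=> uA; apply: contrapT => nex; apply: uA.
apply: sub_countable (countable1 x); apply: subset_card_le => y Ay.
by apply: contrapT => yx; apply: nex; exists y.
Qed.

Lemma uncountable_nonempty T (A : set T) : ~ countable A -> A !=set0.
Proof.
by move=> uA; apply/set0P/eqP => A0; apply: uA; rewrite A0; apply: countable0.
Qed.

Section Main.
Context {d : Order.disp_t} {L : orderType d}.
Hypothesis regL : regular_cardinal_order (L := L).
Hypothesis contL : card_lt [set: set nat] [set: L].

Let wfL : well_founded (fun x y : L => x < y). Proof. by case: regL. Qed.

Lemma card_gt_full (b : L) : [set x | b < x] #= [set: L].
Proof.
have [[c cP]|//] := bounded_or_full regL [set x | b < x].
have [e] := ex_gt regL contL (Order.max b c); rewrite gt_max => /andP[be ce].
by have := cP e be; rewrite ltNge (ltW ce).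
Qed.

Lemma meets_closed_sub (E E' : set L) : E `<=` E' -> meets_closed E -> meets_closed E'.
Proof. by move=> EE' mE h; have [a /EE' ? ?] := mE h; exists a. Qed.

Lemma enumerate_unbounded (S : set L) : (forall b, exists2 a, S a & b < a) ->
  exists r : L -> L, [/\ injective r, forall i, S (r i) & forall a, S a -> exists i, r i = a].
Proof.
have [l0 _] := ex_point contL.
move=> uS; have [[b bP]|SL] := bounded_or_full regL S.
  by have [a Sa ba] := uS b; have := bP a Sa; rewrite ltNge (ltW ba).
have [r [rI rS rsurj]] := bij_of_card_eq l0 (card_esym SL).
exists r; split => [x y|i|a /rsurj[i _ <-]]; [exact: rI|exact: rS|by exists i].
Qed.

Lemma aleph1_sized_image T U (f : T -> U) (A : set T) :
  inj_on A f -> aleph1_sized (L := L) A -> aleph1_sized (L := L) (f @` A).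
Proof.
move=> fI [C oC eAC]; exists C => //; apply: card_eq_trans eAC.
exact: card_eq_image_inj_on.
Qed.

(** * Part (1): the clubsuit sequence and the chromatic numbers *)

Lemma exists_clubsuit (S : set L) :
  stationary S -> S `<=` @E_omega1 _ L -> bigstar S -> diamond S ->
  exists (S' : set L) (B : L -> set L), [/\ S' `<=` S, clubsuit_seq S' B,
    almost_disjoint_on S' B & forall a, S' a -> aleph1_sized (L := L) (B a)].
Proof.
move=> statS SE [A [AP adA]] [D [_ DP]].
have [l0 _] := ex_point contL.
have [a1 Sa1 _] := stationary_meets_closed regL contL statS id.
pose acc a Y := [/\ S a, cofinal_in Y a, Y `<=` D a & aleph1_sized (L := L) Y].
have [|S' [B [accB adB hit]]] :=
  @greedy_almost_disjoint _ _ regL contL L acc a1 (SE _ Sa1).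
  by move=> a Y [].
exists S', B; split => //; try by move=> a /accB[].
split=> [a /accB[]//|X XL].
have := XL; rewrite card_eq_le => /andP[_ /(inj_of_card_le l0)[i iI iX]].
(* As [i] is injective, fewer than lambda points are sent to [b] or below. At points [a] closed
   under [h] this makes the image of [A a] cofinal in [a]. *)
have [b|h hP] := @choice L L (fun b z => forall x, i x <= b -> x < z).
  have [b' bb'] := ex_gt regL contL b.
  have [z zP] : exists z, forall x, [set x | i x <= b] x -> x < z.
    suff : small (L := L) [set x | i x <= b] by move=> /(_ id).
    apply: small_le (small_seg regL b') => //.
    apply: (@card_le_of_inj _ _ _ _ i) => [x y _ _|x ixb]; first exact: iI.
    exact: le_lt_trans bb'.
  by exists z.
pose E : set L := [set a | (S a /\ X `&` seg a = D a) /\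
  closed_under (fun b => Order.max (i b) (h b)) a].
have [||a Ea|a [[Sa aD] _] S'a] := hit E (fun a => i @` A a).
- exact/meets_closedI/(stationary_meets_closed regL contL)/DP.
- move=> a b [[Sa _] _] [[Sb _] _] ab.
  apply: sub_finite_set (finite_image i (adA a b Sa Sb ab)).
  move=> _ [[x Ax <-] [y Ay /iI xy]]; exists x => //; split => //.
  by rewrite -xy.
- move: Ea => [[Sa aD] cla]; have [[Aa Acof] oA] := AP a Sa.
  have cli x : x < a -> i x < a by move=> /cla; rewrite gt_max => /andP[].
  have clh x : x < a -> h x < a by move=> /cla; rewrite gt_max => /andP[].
  split => //; last by apply: aleph1_sized_image => [x y _ _|]; [apply: iI|exists (A a)].
    split=> [_ [x /Aa/cli ixa <-] //|b ba].
    have [x Ax hx] := Acof _ (clh b ba); exists (i x); first by exists x.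
    by rewrite ltNge; apply/negP => /hP; rewrite ltNge (ltW hx).
  by move=> _ [x /Aa/cli ixa <-]; rewrite -aD; split => //; apply: iX.
(* [B a] need not be the image of [A a], but it lies in [D a], the part of [X] below [a]. *)
exists a; split => //; have [_ _ BD _] := accB a S'a.
by move=> x /BD; rewrite -aD => -[].
Qed.

(** Any set of size lambda contains some [B a], so all but boundedly many points have colours below
    [b]. If no [B a] were monochromatic, every colour class would be bounded, and by regularity the
    classes of colours below [b] could not cover a tail. *)
Lemma clubsuit_monochromatic (S : set L) (B : L -> set L) (b : L) (f : L -> L) :
  clubsuit_seq S B -> (forall a, S a -> B a !=set0) ->
  (forall a x, S a -> B a x -> f x < b) ->
  exists2 a, S a & exists c, forall x, B a x -> f x = c.
Proof.
move=> [_ clubS] B0 fb.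
have [l0 _] := ex_point contL.
have [[b1 b1P]|/clubS[a [Sa Ba]]] := bounded_or_full regL [set x | ~ f x < b]; last first.
  by have [x Bx] := B0 a Sa; case: (Ba x Bx); apply: fb Bx.
apply: contrapT => nmono.
have [c|h hP] := @choice L L (fun c z => forall x, f x = c -> x < z).
  have [[z zP]|/clubS[a [Sa Ba]]] := bounded_or_full regL [set x | f x = c].
    by exists z.
  by case: nmono; exists a => //; exists c.
have [b2 b2P] := small_seg regL b h.
have [x] := ex_gt regL contL (Order.max b1 b2); rewrite gt_max => /andP[b1x b2x].
have [fx|nfx] := pselect (f x < b).
  by have := lt_trans (hP _ _ erefl) (b2P _ fx); rewrite ltNge (ltW b2x).
by have := b1P _ nfx; rewrite ltNge (ltW b1x).
Qed.

(** Gives the upper bound lambda: an injective colouring is both proper and conflict-free. *)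
Lemma system_inj_on (a1 : L) T (A : L -> set T) :
  cf_omega1 a1 -> system (aleph1_sized (L := L)) A ->
  exists f : T -> L, inj_on (\bigcup_i A i) f.
Proof.
have [l0 _] := ex_point contL.
move=> cfa1 [A1 _]; apply: (inj_on_bigcup regL contL) => i; have [C oC eAC] := A1 i.
  apply: (small_le contL) (small_otype_omega1 regL contL cfa1 oC).
  by move: eAC; rewrite card_eq_le => /andP[].
by have [f [fI _ _]] := bij_of_card_eq l0 eAC; exists f.
Qed.

Lemma sup_chi (S : set L) (B : L -> set L) (a1 : L) :
  cf_omega1 a1 -> clubsuit_seq S B -> almost_disjoint_on S B ->
  (forall a, S a -> aleph1_sized (L := L) (B a)) ->
  sup_is_lambda (fun T (A : L -> set T) C => cf_colorable A C)
    (fun T (X : set T) => aleph1_sized (L := L) X) /\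
  sup_is_lambda (fun T (A : L -> set T) C => colorable A C)
    (fun T (X : set T) => aleph1_sized (L := L) X).
Proof.
move=> cfa1 clubS adB B1.
have uB a (Sa : S a) := aleph1_sized_uncountable (B1 a Sa).
have B0 a : S a -> B a !=set0 by move=> /uB; apply: uncountable_nonempty.
(* Systems are indexed by all of lambda, so [S] is re-enumerated; it is unbounded because the tail
   above [b] contains some [B a]. *)
have [b|r [rI rS rsurj]] := @enumerate_unbounded S.
  have [a [Sa Ba]] := clubS.2 _ (card_gt_full b); exists a => //.
  have [x Bx] := B0 a Sa; apply: lt_trans (Ba x Bx) _.
  by apply: (clubS.1 a Sa).1.
have sysB : system (aleph1_sized (L := L)) (B \o r).
  by split=> [i|i j ij]; [apply: B1|apply: adB => // /rI].
(* A member with constant colour refutes both kinds of colouring. *)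
have mono (b : L) f : (forall i x, B (r i) x -> seg b (f x)) ->
    exists i c, forall x, B (r i) x -> f x = c.
  move=> fb; have [a x|a /rsurj[i <-] [c cP]] := @clubsuit_monochromatic S B b f clubS B0.
    by move=> /rsurj[i <-]; apply: fb.
  by exists i, c.
split; split.
- move=> T A sA; have [f fI] := system_inj_on cfa1 sA; exists f; split => // i.
  have [x Ax] := uncountable_nonempty (aleph1_sized_uncountable (sA.1 i)).
  exists (f x), x => // y Ay fyx; apply: fI => //; by exists i.
- move=> b; exists L, (B \o r); split => // -[f [/mono[i [c cP]] /(_ i)]].
  move=> [z [x [Bx fx] xP]]; have [y By yx] := uncountable_neq x (uB _ (rS i)).
  by apply: yx; apply: xP => //; rewrite cP // -fx cP.
- move=> T A sA; have [f fI] := system_inj_on cfa1 sA; exists f; split => // i.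
  have uA := aleph1_sized_uncountable (sA.1 i).
  have [x Ax] := uncountable_nonempty uA; have [y Ay yx] := uncountable_neq x uA.
  exists x, y; split => // fxy; apply: yx; apply: fI => //; by exists i.
- move=> b; exists L, (B \o r); split => // -[f [/mono[i [c cP]] /(_ i)]].
  by move=> [x [y [Bx By]]]; apply; rewrite !cP.
Qed.

(** * Part (2): conflict-free colourings with omega_1 colours *)

(* [diamond] guesses subsets of lambda; colourings of lambda * kappa are coded
   by their graphs. *)
Lemma diamond_colouring (S C : set L) (c0 kappa : L) :
  diamond S -> small (L := L) C -> C c0 ->
  exists F : L -> L * L -> L, (forall a z, C (F a z)) /\
    forall f : L * L -> L, (forall z, C (f z)) -> meets_closed
      [set a | S a /\ forall z, z.1 < a -> z.2 < kappa -> F a z = f z].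
Proof.
move=> [D [_ DP]] sC Cc0.
have [||p1 p1I] := @inj_on_bigcup _ _ regL contL (L * L)
    (fun i => [set z | z.1 = i /\ C z.2]).
- move=> i; apply: small_sub (small_image sC (fun y => (i, y))).
  by move=> [x y] [/= -> Cy]; exists y.
- by move=> i; exists snd => -[x y] [x' y'] [/= -> _] [/= -> _] ->.
pose G x : set ((L * L) * L) := [set w | [/\ w.1.1 = x, w.1.2 < kappa & C w.2]].
have sG x : small (L := L) (G x).
  apply: small_sub (small_image
    (small_setX contL (small_seg regL kappa) sC) (fun w => ((x, w.1), w.2))).
  by move=> [[y q] c] [/= -> qk Cc]; exists (q, c).
have [|p pI] := @inj_on_bigcup _ _ regL contL _ G sG.
  move=> x; exists (fun w => p1 (w.1.2, w.2)) => -[[y q] c] [[y' q'] c'].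
  move=> [/= -> _ Cc] [/= -> _ Cc'] pE.
  have : (q, c) = (q', c') by apply: p1I pE; [exists q|exists q'].
  by case=> -> ->.
(* [F] reads off a colour [c] for which the code of [(z, c)] belongs to [D a], with default [c0]. *)
have [[a z]|F FP] := @choice (L * (L * L)) L (fun az c => C c /\
    forall c', C c' -> D az.1 (p (az.2, c')) -> D az.1 (p (az.2, c))).
  have [[c [Cc Dc]]|nex] := pselect (exists c, C c /\ D a (p (z, c))).
    by exists c; split.
  by exists c0; split => // c Cc Dc; case: nex; exists c.
exists (fun a z => F (a, z)); split=> [a z|f fC]; first by case: (FP (a, z)).
(* Closure under [h] puts the codes of all columns before [a] below [a], so that [D a] sees the
   whole graph of [f] there. *)
have [x|h hP] := @choice L L (fun x b => forall w, G x w -> p w < b).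
  by have [b bP] := sG x p; exists b.
pose X : set L := [set y | exists2 z, z.2 < kappa & y = p (z, f z)].
apply: meets_closed_sub (meets_closedI h (stationary_meets_closed regL contL (DP X))).
move=> a [[Sa aD] cla]; split => // z za zk.
have Dz : D a (p (z, F (a, z))).
  apply: ((FP (a, z)).2 (f z)) => //=; rewrite -aD; split; first by exists z.
  by apply: lt_trans (cla _ za); apply: hP; split => /=.
move: Dz; rewrite -aD => -[[z' z'k pE] _].
have : (z, F (a, z)) = (z', f z').
  apply: pI pE; first by exists z.1 => //; split => //; apply: (FP (a, z)).1.
  by exists z'.1 => //; split => //; apply: fC.
by case=> ->.
Qed.

(* A colour is big when it occurs in unboundedly many columns. All other colours
   live below some [beta], so the columns beyond [beta] only use big colours. *)
Lemma big_colour_selector (C : set L) (kappa q0 : L) (f : L * L -> L) :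
  small (L := L) C -> q0 < kappa -> (forall z, C (f z)) ->
  exists (big : set L) (beta i0 : L) (h : L -> L) (e : L -> L -> L * L),
    [/\ big i0, big `<=` C,
      forall z, beta <= z.1 -> z.2 < kappa -> big (f z),
      forall x c, big c ->
        [/\ x <= (e x c).1, (e x c).1 < h x, (e x c).2 < kappa & f (e x c) = c] &
      forall x y c c', big c -> big c' -> (e x c).1 = (e y c').1 -> x = y].
Proof.
move=> sC q0k fC; have [l0 _] := ex_point contL.
pose big : set L := [set c | C c /\
  forall b, exists z, [/\ b <= z.1, z.2 < kappa & f z = c]].
have [c|t tP] := @choice L L (fun c b => C c -> ~ big c ->
    forall z, z.2 < kappa -> f z = c -> z.1 < b).
  have [[Cc nbc]|nC] := pselect (C c /\ ~ big c); last first.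
    by exists l0 => Cc nbc; case: nC.
  apply: contrapT => nex; apply: nbc; split => // b; apply: contrapT => nz.
  apply: nex; exists b => _ _ z zk fz; rewrite ltNge; apply/negP => bz.
  by apply: nz; exists z.
have [beta betaP] := sC t.
have bigP z : beta <= z.1 -> z.2 < kappa -> big (f z).
  move=> bz zk; apply: contrapT => nb.
  have := lt_trans (tP _ (fC z) nb z zk erefl) (betaP _ (fC z)).
  by rewrite ltNge bz.
have [[b c]|nxt nxtP] := @choice (L * L) (L * L) (fun bc z => big bc.2 ->
    [/\ bc.1 <= z.1, z.2 < kappa & f z = bc.2]).
  have [bc|nb] := pselect (big c); last by exists (l0, l0).
  by have [z zP] := bc.2 b; exists z.
(* [n b] bounds the columns of the occurrences chosen from [b] on. Starting points spaced by [n]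
   give different [x] disjoint intervals of columns, whatever the colours. *)
have [b|n nP] := @choice L L (fun b u => forall c, C c -> (nxt (b, c)).1 < u).
  by have [u uP] := sC (fun c => (nxt (b, c)).1); exists u.
have [o [lo oP]] := spaced regL contL (fun _ => n).
have eP x c : big c -> [/\ o x <= (nxt (o x, c)).1, (nxt (o x, c)).1 < n (o x),
    (nxt (o x, c)).2 < kappa & f (nxt (o x, c)) = c].
  move=> bc; have [/= h1 h2 h3] := nxtP (o x, c) bc; split => //.
  by apply: nP; case: bc.
exists big, beta, (f (beta, q0)), (n \o o), (fun x c => nxt (o x, c)); split => //.
- exact: bigP.
- by move=> c [].
- by move=> x c /(eP x)[h1 h2 h3 h4]; split => //; apply: le_trans h1.
move=> x y c c' /(eP x)[x1 x2 _ _] /(eP y)[y1 y2 _ _] exy.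
case: (ltgtP x y) => // /oP lt_o.
  by have := lt_trans x2 (lt_le_trans lt_o y1); rewrite exy ltxx.
by have := lt_trans y2 (lt_le_trans lt_o x1); rewrite exy ltxx.
Qed.

(** Acceptability is phrased through the guess [F a], since the recursion does not know [f]. Where
    the guess is right, spreading the big colours along [A a], each at least twice, over the columns
    of the selector gives an acceptable set. *)
Lemma exists_full_colour_sets (S C : set L) (kappa q0 a1 : L) :
  stationary S -> S `<=` @E_omega1 _ L -> bigstar S -> diamond S ->
  cf_omega1 a1 -> otype_omega1 C -> q0 < kappa ->
  exists (S' : set L) (B : L -> set (L * L)),
    [/\ forall a, S' a -> aleph1_sized (L := L) (B a),
      forall a z, S' a -> B a z -> z.1 < a /\ z.2 < kappa,
      forall a z z', S' a -> B a z -> B a z' -> z.1 = z'.1 -> z = z',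
      almost_disjoint S' B &
      forall (f : L * L -> L) b0, (forall z, C (f z)) ->
        exists a, [/\ S' a, b0 < a,
          forall z, B a z -> exists z', [/\ B a z', z' <> z & f z' = f z] &
          forall q, q < kappa -> exists2 z, B a z & f z = f (a, q)]].
Proof.
move=> statS SE [A [AP adA]] diamS cfa1 oC q0k.
have sC := small_otype_omega1 regL contL cfa1 oC.
have [c0 Cc0] := uncountable_nonempty oC.1.
have [F [FC FP]] := diamond_colouring kappa diamS sC Cc0.
pose acc a (B : set (L * L)) := [/\ aleph1_sized (L := L) B,
  forall z, B z -> z.1 < a /\ z.2 < kappa,
  forall z z', B z -> B z' -> z.1 = z'.1 -> z = z',
  forall z, B z -> exists z', [/\ B z', z' <> z & F a z' = F a z] &
  forall c, (forall b, b < a -> exists z, [/\ b <= z.1, z.1 < a, z.2 < kappa & F a z = c]) ->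
    exists2 z, B z & F a z = c].
have [|S' [B [accB adB hit]]] :=
    @greedy_almost_disjoint _ _ regL contL (L * L) acc a1 cfa1.
  by move=> a Y [].
exists S', B; split => [a /accB[] //|a z|a z z'||f b0 fC] //.
- by move=> /accB[_ h _ _ _]; apply: h.
- by move=> /accB[_ _ h _ _]; apply: h.
have [big [beta [i0 [h [e [bi0 bigC bigP eP eI]]]]]] := big_colour_selector sC q0k fC.
have [a|k kP] := @choice L (L -> L) (fun a k => S a -> (forall x, C (k x)) /\
    forall c, C c -> exists x y, [/\ A a x, A a y, x <> y, k x = c & k y = c]).
  have [Sa|nSa] := pselect (S a); last by exists id.
  by have [k kP] := otype_omega1_twofold_surj wfL (AP a Sa).2 oC Cc0; exists k.
(* [rho] sends the other colours to [i0], so [col a] takes only big colours and, for [a] in [S],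
   each of them at least twice on [A a]. *)
have [c|rho rhoP] := @choice L L (fun c c' => big c' /\ (big c -> c' = c)).
  by have [bc|nbc] := pselect (big c); [exists c|exists i0].
pose col a x := rho (k a x).
have colb a x : big (col a x) := (rhoP _).1.
pose Y a := (fun x => e x (col a x)) @` A a.
have YI a : inj_on (A a) (fun x => e x (col a x)).
  by move=> x y _ _ exy; apply: (eI x y (col a x) (col a y)) => //; rewrite exy.
(* Beyond [beta], column [a] has only big colours; closure under [h] keeps [Y a] in the columns
   before [a]. *)
pose E : set L := [set a | ((S a /\ forall z, z.1 < a -> z.2 < kappa -> F a z = f z) /\
  closed_under h a) /\ Order.max beta b0 < a].
have mE : meets_closed E.
  apply: meets_closed_unbounded => //; first exact/meets_closedI/FP.
  move=> a [[Sa _] _]; have [x Ax] := uncountable_nonempty (AP a Sa).2.1.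
  by exists x; apply: (AP a Sa).1.1.
have adE : almost_disjoint E Y.
  move=> a b [[[Sa _] _] _] [[[Sb _] _] _] ab.
  apply: sub_finite_set (finite_image (fun x => e x (col a x)) (adA a b Sa Sb ab)).
  move=> _ [[x Ax <-] [y Ay exy]]; exists x => //; split => //.
  by rewrite (eI x y (col a x) (col b y)) // exy.
have [|a [[[Sa aF] cla] betaa] Sa'] := hit E Y mE adE.
  move=> a [[[Sa aF] cla]]; rewrite gt_max => /andP[ba _].
  have Ylt z : Y a z -> z.1 < a /\ z.2 < kappa.
    move=> [x Ax <-]; have [_ h1 h2 _] := eP x _ (colb a x); split => //.
    by apply: lt_trans h1 (cla _ _); apply: (AP a Sa).1.1.
  have FY z : Y a z -> F a z = f z by move=> /Ylt[]; apply: aF.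
  have fe x c : big c -> f (e x c) = c by move=> /(eP x)[].
  have colE x c : big c -> k a x = c -> col a x = c.
    by move=> bc kx; rewrite /col kx; apply: (rhoP c).2.
  split => //.
  - by apply: aleph1_sized_image => //; exists (A a) => //; case: (AP a Sa).
  - move=> _ _ [x Ax <-] [y Ay <-] exy.
    by rewrite (eI x y (col a x) (col a y)).
  - move=> z Yz; case: (Yz) => x Ax zE.
    have bc := colb a x; have [x1 [x2 [A1 A2 x12 k1 k2]]] := (kP a Sa).2 _ (bigC _ bc).
    have [y [Ay yx ky]] : exists y, [/\ A a y, y <> x & k a y = col a x].
      have [x1x|x1x] := pselect (x1 = x); last by exists x1.
      by exists x2; split => //; rewrite -x1x => /esym.
    have Yy : Y a (e y (col a y)) by exists y.
    exists (e y (col a y)); split => //.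
      by rewrite -zE => eyx; apply: yx; apply: (YI a).
    by rewrite !FY // -zE !fe //; apply: colE.
  (* A colour guessed cofinally below [a] occurs beyond [beta], hence is big. *)
  - move=> c cP; have [z [bz za zk Fz]] := cP _ ba.
    have bc : big c by rewrite -Fz aF //; apply: bigP.
    have [x [_ [Ax _ _ kx _]]] := (kP a Sa).2 _ (bigC _ bc).
    have Yx : Y a (e x (col a x)) by exists x.
    by exists (e x (col a x)) => //; rewrite FY // (colE x c) // fe.
move: betaa; rewrite gt_max => /andP[ba b0a].
have [_ Blt _ Bdup Bfull] := accB a Sa'.
have FB z : B a z -> F a z = f z by move=> /Blt[]; apply: aF.
exists a; split => // [z Bz|q qk].
  by have [z' [Bz' z'z Fz']] := Bdup z Bz; exists z'; split => //; rewrite -!FB.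
have bf : big (f (a, q)) by apply: bigP => //=; apply: ltW.
(* The big colour [f (a, q)] occurs cofinally below [a] by closure under [h], so acceptability puts
   it into [B a]. *)
have [b bla|z Bz Fz] := Bfull (f (a, q)); last by exists z; rewrite // -FB.
have [e1 e2 e3 e4] := eP b _ bf; have ea := lt_trans e2 (cla _ bla).
by exists (e b (f (a, q))); split; rewrite // aF.
Qed.

(* Removing a copy of omega_1 from the column part makes room for [B], so that
   the members have size exactly kappa without using kappa + omega_1 = kappa. *)
Lemma chi_CF_gt_omega1 (S : set L) (a1 kappa : L) :
  stationary S -> S `<=` @E_omega1 _ L -> bigstar S -> diamond S -> S a1 ->
  ~ countable (seg kappa) ->
  exists (T : Type) (A : L -> set T),
    system (fun X : set T => X #= seg kappa) A /\
    forall C : set L, otype_omega1 C -> ~ cf_colorable A C.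
Proof.
move=> statS SE bigS diamS Sa1 uk.
have [A [/(_ _ Sa1)[_ oC] _]] := bigS; set C := A a1 in oC.
have [c0 Cc0] := uncountable_nonempty oC.1.
have [q0 q0k] := uncountable_nonempty uk.
have [S' [B [B1 Blt Bfun adB fullB]]] :=
  exists_full_colour_sets statS SE bigS diamS (SE _ Sa1) oC q0k.
have [b|r [rI rS rsurj]] := @enumerate_unbounded S'.
  by have [a [Sa ba _ _]] := fullB (fun=> c0) b (fun=> Cc0); exists a.
have [g gI gk] := inj_of_card_le c0 (otype_omega1_card_le wfL oC uk).
pose Q := seg kappa `\` g @` C.
pose P a : set (L * L) := [set z | z.1 = a /\ Q z.2].
exists (L * L)%type, (fun i => B (r i) `|` P (r i)); split; first split.
- move=> i; have -> : seg kappa = g @` C `|` Q.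
    apply/seteqP; split=> [x xk|x [[c Cc <-]|[]] //]; last exact: gk.
    by have [gx|ngx] := pselect ((g @` C) x); [left|right].
  apply: card_eqU => //.
  + apply: card_eq_trans (aleph1_sizedE wfL oC (B1 _ (rS i))) _.
    by apply: card_esym; apply: card_eq_image_inj_on.
  + have -> : P (r i) = (fun q => (r i, q)) @` Q.
      by apply/seteqP; split=> [[x q] [/= -> Qq]|_ [q Qq <-]//]; exists q.
    by apply: card_eq_image_inj_on => x y _ _ [].
  + apply/seteqP; split => // z [/(Blt _ _ (rS i))[zr _] [zE _]].
    by move: zr; rewrite zE ltxx.
  + by apply/seteqP; split => // x [gx [_]].
- move=> i j ij; have rij : r i <> r j by move=> /rI.
  (* [B a] meets each column in at most one point. *)
  have fin_BP a b : S' a -> finite_set (B a `&` P b).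
    move=> Sa; apply: finite_subsingleton => z z' [Bz [zb _]] [Bz' [zb' _]].
    by apply: Bfun Bz Bz' _ => //; rewrite zb.
  apply: (@sub_finite_set _ _ ((B (r i) `&` B (r j)) `|` (B (r i) `&` P (r j)) `|`
      (B (r j) `&` P (r i)))).
    move=> z [[Biz|Piz] [Bjz|Pjz]]; [by left; left|by left; right|by right|].
    by case: rij; rewrite -(proj1 Piz) -(proj1 Pjz).
  rewrite !finite_setU; split; last exact: fin_BP.
  by split; [apply: adB|apply: fin_BP].
move=> C' oC' [f [fC' cf]].
have [g' g'I g'C] := inj_of_card_le c0 (otype_omega1_card_le wfL oC' oC.1).
(* The colours in [C'] are carried into [C] by [g']; the default [c0] makes [f'] take values in [C]
   everywhere. *)
have [z|f' f'P] := @choice (L * L) L (fun z c => C c /\ (C' (f z) -> c = g' (f z))).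
  by have [C'z|nC'z] := pselect (C' (f z)); [exists (g' (f z)); split => //; apply: g'C|exists c0].
have [a [S'a _ Bdup Bfull]] := fullB f' c0 (fun z => (f'P z).1).
have [i ia] := rsurj a S'a; have [y [x [Mx fx] xP]] := cf i.
have eq_f u v : (B a `|` P a) u -> (B a `|` P a) v -> f' u = f' v -> f u = f v.
  rewrite -ia => /fC' Cu /fC' Cv; rewrite (f'P u).2 // (f'P v).2 //.
  exact: g'I.
(* A uniquely coloured [x] lies neither in [B a], where colours repeat, nor in column [a], whose
   colours all recur in [B a], in earlier columns. *)
rewrite ia in Mx xP; case: (Mx) => [Bx|[xa [xk _]]].
  have [x' [Bx' x'x f'x']] := Bdup x Bx; apply: x'x; apply: xP; first by left.
  by rewrite -fx; apply: eq_f => //; left.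
have [z Bz f'z] := Bfull x.2 xk; have [za _] := Blt a z S'a Bz.
have zx : z = x.
  apply: xP; first by left.
  by rewrite -fx; apply: eq_f => //; [left|rewrite f'z -xa; case: (x)].
by move: za; rewrite zx xa ltxx.
Qed.

End Main.

Theorem theorem9p1 (d : Order.disp_t) (L : orderType d) :
  regular_cardinal_order (L := L) ->
  card_lt [set: set nat] [set: L] ->
  forall S : set L, stationary S -> S `<=` E_omega1 -> bigstar S -> diamond S ->
  ((exists S' : set L, exists B : L -> set L,
       S' `<=` S /\ clubsuit_seq S' B /\ almost_disjoint_on S' B) /\
   sup_is_lambda (fun T (A : L -> set T) C => cf_colorable A C) (fun T (X : set T) => aleph1_sized (L := L) X) /\
   sup_is_lambda (fun T (A : L -> set T) C => colorable A C) (fun T (X : set T) => aleph1_sized (L := L) X)) /\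
  (forall kappa : L, ~ le_aleph1 (L := L) (seg kappa) ->
     exists (T : Type) (A : L -> set T),
       system (fun X : set T => X #= seg kappa) A /\
       forall C : set L, otype_omega1 C -> ~ cf_colorable A C).
Proof.
move=> regL contL S statS SE bigS diamS.
have [a1 Sa1 _] := stationary_meets_closed regL contL statS id.
have [S' [B [S'S clubS' adB B1]]] := exists_clubsuit regL contL statS SE bigS diamS.
split.
  by split; [exists S', B|exact: (sup_chi regL contL (SE _ Sa1) clubS' adB B1)].
move=> kappa kappa_big; apply: (chi_CF_gt_omega1 regL contL statS SE bigS diamS Sa1).
(* A countable [seg kappa] would inject into the infinite set [A a1], of type omega_1. *)
have [A [/(_ _ Sa1)[_ oC] _]] := bigS; move=> ck; apply: kappa_big.
exists (A a1) => //; apply: card_le_trans ck _; apply/infiniteP.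
by move=> /finite_set_countable; case: oC.
Qed.
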